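(* Let $\mathfrak X$ be a homogeneous tree of degree $q+1$ ($q\geq1$). Fix integers $k,\ell$ with $2\leq k<\ell$, let $d=\gcd(k,\ell)$, and let $W(x)=\dfrac{U_{k-1}(x)}{U_{d-1}(x)}$ and $V(x)=\dfrac{U_{\ell-1}(x)}{U_{d-1}(x)}$ (these are polynomials). Then for all $f,g,h\in\mathcal F(\mathfrak X)$, the condition $$W(\mu_1)\big(g+U_{\ell-2}(\mu_1)f\big)=V(\mu_1)\big(h+U_{k-2}(\mu_1)f\big)$$ is necessary and sufficient for the existence of a wave $\{f_j\}_{j\in\mathbb Z}$ with $f_0=f$, $f_\ell=g$, and $f_k=h$.
   Context: $\mathfrak X$ is a tree in which every vertex has exactly $q+1$ edges; $\mathcal F(\mathfrak X)$ is the space of complex-valued functions on its vertices; $\mu_1f(v)=\frac{1}{q+1}\sum_{w\text{ adjacent to }v}f(w)$. A wave is a family $\{f_j\}_{j\in\mathbb Z}$ in $\mathcal F(\mathfrak X)$ with $\mu_1f_j=\frac{f_{j+1}+f_{j-1}}{2}$ for all $j\in\mathbb Z$. $U_n$: Chebyshev polynomials of the second kind, $U_0=1$, $U_1(x)=2x$, $U_n=2xU_{n-1}-U_{n-2}$; polynomials are applied to the operator $\mu_1$. *)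

(* Defs.v *)
From HB Require Import structures.
From mathcomp Require Import all_boot all_order all_algebra.
From mathcomp Require Import all_classical reals.
From mathcomp Require Import complex.

Set Implicit Arguments.
Unset Strict Implicit.
Unset Printing Implicit Defensive.

Import Order.TTheory GRing.Theory Num.Theory.

Local Open Scope classical_set_scope.
Local Open Scope ring_scope.

Definition neighbors (T : Type) (adj : rel T) (v : T) : set T :=
  [set w | adj v w].

(* Cycles of the graph have at least three distinct vertices: the sequence
   [:: v; w] satisfies ucycle adj as soon as v and w are adjacent. *)
Definition is_tree (T : eqType) (adj : rel T) : Prop :=
  [/\ [set: T] !=set0,
      symmetric adj /\ irreflexive adj,
      forall v w : T, exists2 p : seq T, path adj v p & last v p = w
    & forall c : seq T, (2 < size c)%N -> ~ ucycle adj c].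

Definition homogeneous_tree (q : nat) (T : eqType) (adj : rel T) : Prop :=
  is_tree adj /\ forall v : T, (neighbors adj v #= `I_q.+1)%card.

(* R[i]^o is R[i] seen as a module over itself, so that the function space
   inherits its R[i]-module structure from the library. *)
Notation vfun R T := (T -> R[i]^o).

Definition mu1 (R : realType) (q : nat) (T : choiceType) (adj : rel T)
    (f : vfun R T) : vfun R T :=
  fun v => (q.+1%:R)^-1 *: \sum_(w \in neighbors adj v) f w.

Definition wave (R : realType) (q : nat) (T : choiceType) (adj : rel T)
    (F : int -> vfun R T) : Prop :=
  forall j : int, mu1 q adj (F j) = 2^-1 *: (F (j + 1) + F (j - 1)).

Fixpoint chebU (K : nzRingType) (n : nat) : {poly K} :=
  match n with
  | 0 => 1
  | m.+1 => match m with
            | 0 => 2 *: 'X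
            | p.+1 => 2 *: 'X * chebU K m - chebU K p
            end
  end.

Definition poly_op (K : nzRingType) (V : lmodType K) (p : {poly K})
    (A : V -> V) (x : V) : V :=
  \sum_(i < size p) p`_i *: iter i A x.

(* Main.v *)
(* A wave is determined by f_0 and u = f_1: f_n = U_(n-1)(mu_1) u - U_(n-2)(mu_1) f_0.
   A wave through f, g, h is thus a solution u of U_(k-1)(mu_1) u = H and
   U_(l-1)(mu_1) u = G, where H = h + U_(k-2)(mu_1) f and G = g + U_(l-2)(mu_1) f.
   The sequence U_(n-1) is a strong divisibility sequence, so W and V are coprime
   with U_(k-1) = W U_(d-1) and U_(l-1) = V U_(d-1).  If W G = V H, a Bezout relation
   a W + b V = 1 yields w = b G + a H with W w = H and V w = G, and it remains to
   solve U_(d-1)(mu_1) u = w.  Over the complex numbers this reduces to the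
   surjectivity of mu_1 - z: rooting the tree, one solves the equation at each v for
   the value at a chosen child of v, going away from the root. *)

Require Import Defs.
From HB Require Import structures.
From mathcomp Require Import all_boot all_order all_algebra.
From mathcomp Require Import all_classical reals.
From mathcomp Require Import complex ring zify.

Set Implicit Arguments.
Unset Strict Implicit.
Unset Printing Implicit Defensive.

Import Order.TTheory GRing.Theory Num.Theory.

Local Open Scope ring_scope.

(* [chebS K n] is [U_(n-1)], so that [chebS K 0 = 0]. *)
Definition chebS (K : nzRingType) (n : nat) : {poly K} :=
  if n is m.+1 then chebU K m else 0.

(** * Polynomials in a linear operator *)

Section PolyOp.
Variables (K : comNzRingType) (V : lmodType K) (A : {linear V -> V}).
Implicit Types (p r : {poly K}) (x y : V).

Lemma poly_op_widen p x n : (size p <= n)%N ->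
  poly_op p A x = \sum_(i < n) p`_i *: iter i A x.
Proof.
move=> pn; rewrite /poly_op -!(big_mkord xpredT (fun i => p`_i *: iter i A x)).
rewrite [RHS](big_cat_nat (n := size p)) //= [X in _ = _ + X]big1_seq ?addr0 //.
by move=> i; rewrite mem_index_iota => /andP[_ /andP[pi _]]; rewrite nth_default ?scale0r.
Qed.

Lemma poly_op0 x : poly_op 0 A x = 0.
Proof. by rewrite /poly_op size_poly0 big_ord0. Qed.

Lemma poly_op1 x : poly_op 1 A x = x.
Proof. by rewrite /poly_op size_poly1 big_ord1 coef1 scale1r. Qed.

Lemma poly_opD p r x : poly_op (p + r) A x = poly_op p A x + poly_op r A x.
Proof.
pose n := maxn (size p) (size r).
rewrite (@poly_op_widen (p + r) x n) ?size_polyD //.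
rewrite (@poly_op_widen p x n) ?leq_maxl //.
rewrite (@poly_op_widen r x n) ?leq_maxr //.
by rewrite -big_split; apply: eq_bigr => i _; rewrite coefD scalerDl.
Qed.

Lemma poly_opZ c p x : poly_op (c *: p) A x = c *: poly_op p A x.
Proof.
rewrite (@poly_op_widen (c *: p) x (size p)) ?size_scale_leq // /poly_op scaler_sumr.
by apply: eq_bigr => i _; rewrite coefZ scalerA.
Qed.

Lemma poly_opN p x : poly_op (- p) A x = - poly_op p A x.
Proof. by rewrite -[- p]scaleN1r poly_opZ scaleN1r. Qed.

Lemma poly_opB p r x : poly_op (p - r) A x = poly_op p A x - poly_op r A x.
Proof. by rewrite poly_opD poly_opN. Qed.

Lemma poly_op_linear p x y c :
  poly_op p A (c *: x + y) = c *: poly_op p A x + poly_op p A y.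
Proof.
rewrite /poly_op scaler_sumr -big_split; apply: eq_bigr => i _.
suff -> : iter i A (c *: x + y) = c *: iter i A x + iter i A y.
  by rewrite scalerDr !scalerA mulrC.
by elim: (nat_of_ord i) => //= n ->; rewrite linearP.
Qed.

Lemma poly_op_vecD p x y : poly_op p A (x + y) = poly_op p A x + poly_op p A y.
Proof. by have := poly_op_linear p x y 1; rewrite !scale1r. Qed.

Lemma poly_opXM p x : poly_op ('X * p) A x = A (poly_op p A x).
Proof.
rewrite (@poly_op_widen _ x (size p).+1); last first.
  by rewrite (leq_trans (size_polyMleq _ _)) // size_polyX.
rewrite big_ord_recl coefXM eqxx scale0r add0r /poly_op linear_sum.
by apply: eq_bigr => i _; rewrite coefXM /= linearZ.
Qed.

Lemma poly_opM p r x : poly_op (p * r) A x = poly_op p A (poly_op r A x).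
Proof.
elim/poly_ind: p => [|p c IH]; first by rewrite mul0r !poly_op0.
rewrite mulrDl -mulrA mulrCA mul_polyC [p * 'X]mulrC -[c%:P]mulr1 mul_polyC.
by rewrite !poly_opD !poly_opZ !poly_opXM IH poly_op1.
Qed.

End PolyOp.

(** * Chebyshev recurrence, addition formula, extension to integer indices *)

Section Chebyshev.
Variable K : comNzRingType.
Local Notation S := (chebS K).

Lemma chebSS n : S n.+2 = 2 *: 'X * S n.+1 - S n.
Proof. by case: n => [|n] //=; rewrite mulr1 subr0. Qed.

(** With [S n] read as sin(n t)/sin(t), this is a product-to-sum identity for sines. It drives the
    Euclidean step on indices. *)
Lemma chebS_add m n : S (m + n.+1) = S m.+1 * S n.+1 - S m * S n.
Proof.
elim/ltn_ind: m n => -[|[|m]] IH n.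
- by rewrite /= mul1r mul0r subr0.
- by rewrite add1n chebSS /= mul1r.
- rewrite !addSn chebSS -addSn !IH // (chebSS m.+1).
  have -> : S m = 2 *: 'X * S m.+1 - S m.+2 by rewrite chebSS opprB addrC subrK.
  move: (S m.+2) (S m.+1) (S n.+1) (S n) (2 *: 'X) => a b c e x; ring.
Qed.

Lemma chebS_horner1 n : (S n).[1] = n%:R.
Proof.
elim/ltn_ind: n => -[|[|n]] IH; rewrite ?hornerC //.
rewrite chebSS hornerD hornerN hornerM hornerZ hornerX !IH //.
by rewrite mulr1 -natrM -natrB; [congr _%:R|]; lia.
Qed.

(** The odd extension of [S] ([Negz n] is -(n+1)), which keeps the recurrence valid at every
    integer. *)
Definition chebZ (j : int) : {poly K} :=
  match j with Posz n => S n | Negz n => - S n.+1 end.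

Lemma chebZ_rec j : chebZ (j + 1) + chebZ (j - 1) = 2 *: 'X * chebZ j.
Proof.
case: j => [[|n]|[|n]].
- by rewrite /= addrN mulr0.
- have -> : Posz n.+1 + 1 = Posz n.+2 by lia.
  have -> : Posz n.+1 - 1 = Posz n by lia.
  by rewrite /chebZ chebSS subrK.
- by rewrite /= add0r mulrN mulr1.
- have -> : Negz n.+1 + 1 = Negz n by lia.
  have -> : Negz n.+1 - 1 = Negz n.+2 by lia.
  by rewrite /chebZ (chebSS n.+1) opprB addrA addNr sub0r mulrN.
Qed.

End Chebyshev.

(** * Strong divisibility of the Chebyshev sequence *)

Section ChebyshevGcd.
Variable K : fieldType.
Local Notation S := (chebS K).

Lemma coprimep_chebSS n : coprimep (S n) (S n.+1).
Proof.
elim: n => [|n IH]; first by rewrite /= coprimep1.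
rewrite chebSS coprimep_addl_mul -[- S n]scaleN1r.
by rewrite coprimepZr ?oppr_eq0 ?oner_eq0 // coprimep_sym.
Qed.

(** For a positive index, the addition formula leaves, modulo [S n.+1], only [- S m * S n], and the
    factor [S n] is coprime to [S n.+1]. *)
Lemma gcdp_chebS_addl m n : gcdp (S (m + n)) (S n) %= gcdp (S m) (S n).
Proof.
case: n => [|n]; first by rewrite addn0 eqpxx.
rewrite chebS_add -mulNr; rewrite (eqp_ltrans (gcdpC _ _)).
rewrite (eqp_ltrans (gcdp_addl_mul _ _ _)).
rewrite (eqp_ltrans (Gauss_gcdpl _ _)); last by rewrite coprimep_sym coprimep_chebSS.
rewrite (eqp_ltrans (gcdpC _ _)); apply: eqp_gcdl.
by rewrite -scaleN1r eqp_scale // oppr_eq0 oner_eq0.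
Qed.

(** Subtractive Euclidean algorithm on the indices, by induction on a bound for [m + n]. *)
Lemma gcdp_chebS m n : gcdp (S m) (S n) %= S (gcdn m n).
Proof.
have [s] := ubnP (m + n); elim: s m n => // s IH m n.
wlog nm : m n / (n <= m)%N => [hw|].
  have [|/ltnW] := leqP n m; first exact: hw.
  move=> mn ms; rewrite (eqp_ltrans (gcdpC _ _)); rewrite gcdnC.
  by apply: hw; rewrite // addnC.
case: (posnP n) => [-> _|n0 ms]; first by rewrite gcdn0 gcdp0 eqpxx.
rewrite -(subnK nm); rewrite (eqp_ltrans (gcdp_chebS_addl _ _)).
by rewrite gcdnC gcdnDr gcdnC IH //; lia.
Qed.

End ChebyshevGcd.

Section ChebyshevNum.
Variable K : numFieldType.
Local Notation S := (chebS K).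

(** The value at 1 is [n], nonzero in characteristic zero. *)
Lemma chebS_neq0 n : (0 < n)%N -> S n != 0.
Proof.
move=> n0; apply/eqP => /(congr1 (fun p => p.[1])) /eqP.
by rewrite chebS_horner1 horner0 pnatr_eq0 eqn0Ngt n0.
Qed.

Lemma dvdp_chebS m n : (m %| n)%N -> S m %| S n.
Proof.
by move=> /gcdn_idPl mn; rewrite -{1}mn -(eqp_dvdl _ (gcdp_chebS K m n)) dvdp_gcdr.
Qed.

Lemma coprimep_chebS_div m n : (0 < m)%N ->
  let D := S (gcdn m n) in coprimep (S m %/ D) (S n %/ D).
Proof.
move=> m0 /=; set D := S (gcdn _ _).
have D0 : D != 0 by rewrite chebS_neq0 // gcdn_gt0 m0.
have := gcdp_chebS K m n; rewrite -/D => gD.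
have [Dm Dn] : D %| S m /\ D %| S n by split; apply: dvdp_chebS; rewrite ?dvdn_gcdl ?dvdn_gcdr.
rewrite -gcdp_eqp1 -(eqp_mul2r _ _ D0) mul1r (eqp_ltrans (mulp_gcdl _ _ _)).
by rewrite !divpK.
Qed.

End ChebyshevNum.

(** * Waves of an abstract linear operator *)

Section Waves.
Variables (K : numClosedFieldType) (V : lmodType K) (A : {linear V -> V}).
Local Notation S := (chebS K).
Local Notation "p @@ x" := (poly_op p A x) (at level 40).

Definition is_wave (F : int -> V) : Prop :=
  forall j : int, A (F j) = 2^-1 *: (F (j + 1) + F (j - 1)).

Lemma is_wave_next F j : is_wave F -> F (j + 1) = 2 *: A (F j) - F (j - 1).
Proof. by move=> ->; rewrite scalerA divff ?scale1r ?addrK // pnatr_eq0. Qed.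

Lemma poly_op_2XM p x : (2 *: 'X * p) @@ x = 2 *: A (p @@ x).
Proof. by rewrite -scalerAl poly_opZ poly_opXM. Qed.

Lemma poly_op_chebSS n x : S n.+2 @@ x = 2 *: A (S n.+1 @@ x) - S n @@ x.
Proof. by rewrite chebSS poly_opB poly_op_2XM. Qed.

Lemma is_wave_chebS F (n : nat) : is_wave F -> (0 < n)%N ->
  F n = S n @@ F 1 - S n.-1 @@ F 0.
Proof.
move=> Fw; elim/ltn_ind: n => -[|[|[|n]]] IH //= _.
- by rewrite poly_op1 poly_op0 subr0.
- have -> : Posz 2 = 1 + 1 by lia.
  by rewrite (is_wave_next _ Fw) subrr (poly_op_chebSS 0) poly_op0 subr0 !poly_op1.
- have -> : Posz n.+3 = Posz n.+2 + 1 by lia.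
  rewrite (is_wave_next _ Fw) (_ : Posz n.+2 - 1 = n.+1); last by lia.
  rewrite (IH n.+2) // (IH n.+1) // (poly_op_chebSS n.+1).
  rewrite [in RHS](poly_op_chebSS n (F 0)).
  rewrite linearB scalerBr !opprB addrACA [RHS]addrACA; congr (_ + _).
  exact: addrC.
Qed.

(** This is the wave with value [x] at 0 and [y] at 1, so these two values can be prescribed
    freely. *)
Lemma is_wave_chebZ x y :
  is_wave (fun j => chebZ K j @@ y - chebZ K (j - 1) @@ x).
Proof.
move=> j; rewrite addrK.
have -> : chebZ K (j + 1) @@ y - chebZ K j @@ x +
    (chebZ K (j - 1) @@ y - chebZ K (j - 1 - 1) @@ x) =
  (chebZ K (j + 1) + chebZ K (j - 1)) @@ y
  - (chebZ K (j - 1 + 1) + chebZ K (j - 1 - 1)) @@ x.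
  by rewrite !poly_opD subrK addrACA opprD.
rewrite !chebZ_rec !poly_op_2XM -scalerBr scalerA mulVf ?pnatr_eq0 //.
by rewrite scale1r linearB.
Qed.

(** Over an algebraically closed field [p] splits, so [p] of [A] is a nonzero scalar times a
    composite of surjective maps [A - z]. *)
Lemma poly_op_surj p :
    (forall z y, exists x, A x - z *: x = y) -> p != 0 ->
  forall y, exists x, p @@ x = y.
Proof.
move=> surjA p0 y; have [r ->] := closed_field_poly_normal p.
have lp0 : lead_coef p != 0 by rewrite lead_coef_eq0.
suff [x xE] : exists x, (\prod_(z <- r) ('X - z%:P)) @@ x = (lead_coef p)^-1 *: y.
  by exists x; rewrite poly_opZ xE scalerA divff // scale1r.
elim: r (_ *: y) => [|z r IH] w; first by exists w; rewrite big_nil poly_op1.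
have [u uw] := surjA z w; have [x xu] := IH u.
exists x; rewrite big_cons poly_opM xu poly_opB -['X]mulr1 poly_opXM.
by rewrite -alg_polyC poly_opZ !poly_op1.
Qed.

Lemma wave_through (k l : nat) (f g h : V) :
    (forall z y, exists x, A x - z *: x = y) -> (0 < k)%N -> (0 < l)%N ->
  let D := S (gcdn k l) in
  (S k %/ D) @@ (g + S l.-1 @@ f) = (S l %/ D) @@ (h + S k.-1 @@ f) <->
  exists F : int -> V, [/\ is_wave F, F 0 = f, F l = g & F k = h].
Proof.
move=> surjA k0 l0 D; set W := S k %/ D; set Q := S l %/ D.
have D0 : D != 0 by rewrite chebS_neq0 // gcdn_gt0 k0.
have kE : S k = W * D by rewrite divpK // dvdp_chebS ?dvdn_gcdl.
have lE : S l = Q * D by rewrite divpK // dvdp_chebS ?dvdn_gcdr.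
split=> [WQ|[F [Fw <- <- <-]]]; last first.
  (* Both sides become [W * Q * D] applied to [F 1]. *)
  rewrite (is_wave_chebS Fw k0) (is_wave_chebS Fw l0) !subrK kE lE -!poly_opM.
  by congr (_ @@ _); rewrite !mulrA [W * Q]mulrC.
have /Bezout_eq1_coprimepP[[a b] /= ab] : coprimep W Q by exact: coprimep_chebS_div.
set G := g + _ in WQ; set H := h + _ in WQ.
have [y yE] := poly_op_surj surjA D0 (b @@ G + a @@ H).
have yG : S l @@ y = G.
  rewrite lE poly_opM yE poly_op_vecD -!poly_opM [Q * a]mulrC [(a * Q) @@ _]poly_opM -WQ.
  by rewrite -poly_opM -poly_opD [Q * b]mulrC addrC ab poly_op1.
have yH : S k @@ y = H.
  rewrite kE poly_opM yE poly_op_vecD -!poly_opM [W * b]mulrC [(b * W) @@ _]poly_opM WQ.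
  by rewrite -poly_opM -poly_opD [W * a]mulrC addrC ab poly_op1.
exists (fun j => chebZ K j @@ y - chebZ K (j - 1) @@ f); split.
- exact: is_wave_chebZ.
- by rewrite /= poly_op0 poly_opN poly_op1 sub0r opprK.
- by rewrite (_ : Posz l - 1 = l.-1) ?yG ?addrK //; lia.
- by rewrite (_ : Posz k - 1 = k.-1) ?yH ?addrK //; lia.
Qed.

End Waves.


(* [d] is the distance to a root. Paths from the root to two such neighbours [a]
   and [b] can be chosen to avoid [v], so [a <> b] would close a cycle through [v]. *)
Lemma tree_level (T : eqType) (adj : rel T) : is_tree adj ->
  exists d : T -> nat, forall v a b, adj v a -> adj v b ->
    (d a <= d v)%N -> (d b <= d v)%N -> a = b.
Proof.
move=> [[o _] [adjC adjI] conn acyc].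
have dist v : exists n, (exists2 p, path adj o p /\ last o p = v & size p = n) /\
    forall p, path adj o p -> last o p = v -> (n <= size p)%N.
  pose P n := `[< exists2 p, path adj o p /\ last o p = v & size p = n >].
  have exP : exists n, P n.
    by have [p op pv] := conn o v; exists (size p); apply/asboolP; exists p.
  case: (ex_minnP exP) => n /asboolP nP nmin; exists n; split=> // p op pv.
  by apply: nmin; apply/asboolP; exists p.
have [d dP] := choice dist; exists d => v a b va vb dav dbv.
(* A shortest path to [x] through [v] would have at least [d v] edges up to [v] and one more after
   it, exceeding [d x]. *)
have avoid x : adj v x -> (d x <= d v)%N ->
    exists p, [/\ path adj o p, last o p = x & v \notin o :: p].
  move=> vx dxv; have [[p [op px] sp] _] := dP x; exists p; split=> //.
  apply/negP => vp; case/splitPl: vp op px sp => p1 p2 p1v.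
  rewrite cat_path last_cat size_cat p1v => /andP[op1 _] p2x sp.
  have [_ /(_ _ op1 p1v) dv] := dP v.
  case: p2 p2x sp => [/= vE|y p2 _ /=]; first by rewrite vE adjI in vx.
  by lia.
have [p [op pa vp]] := avoid a va dav; have [r [or rb vr]] := avoid b vb dbv.
apply/eqP; apply: contraT => ab.
(* The walk from [a] back to the root, then out to [b]. *)
pose s := rev (belast o p) ++ r.
have ls : last a (rev (belast o p)) = o.
  by rewrite -pa; case: (p) => //= y p'; rewrite rev_cons last_rcons.
have sP : path adj a s.
  rewrite cat_path ls or andbT -pa rev_path.
  by rewrite (@eq_path _ _ adj) // => y z; rewrite /= adjC.
have sb : last a s = b by rewrite last_cat ls.
have vs : v \notin s.
  rewrite mem_cat mem_rev negb_or; move: vp vr; rewrite lastI mem_rcons !inE !negb_or.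
  by move=> /andP[_ ->] /andP[_ ->].
(* Removing repetitions keeps the endpoints and adds no vertex, so [v] is still avoided and closes
   the cycle. *)
case/shortenP: sP sb => t ta ut ts tb.
case: (acyc (v :: a :: t)).
  by case: t tb {ta ut ts} => // /eqP; rewrite (negbTE ab).
rewrite /ucycle /= in ut *.
rewrite rcons_path tb ta va adjC vb /= ut inE negb_or andbT.
apply/andP; split; last exact: contra (ts v) vs.
by apply/eqP => vaE; rewrite vaE adjI in va.
Qed.

(** Iterating [E] from any start stabilises at [v] after [d v + 1] steps, as [E u v] only reads [u]
    on lower levels. *)
Lemma level_recursion (T V : Type) (v0 : V) (d : T -> nat)
    (E : (T -> V) -> T -> V) :
    (forall u u' v, (forall w, (d w < d v)%N -> u w = u' w) -> E u v = E u' v) ->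
  exists u, forall v, u v = E u v.
Proof.
move=> Eext; pose F n := iter n E (fun=> v0).
have Fstable n m v : (d v < n)%N -> (d v < m)%N -> F n v = F m v.
  elim: n m v => [|n IH] [|m] v // dn dm.
  by apply: Eext => w wv; apply: IH; [move: dn | move: dm]; lia.
exists (fun v => F (d v).+1 v) => v; apply: Eext => w wv.
by apply: Fstable => //; lia.
Qed.

(** * Surjectivity of [mu1 - z] on the tree *)

Section Tree.
Local Open Scope classical_set_scope.
Variables (R : realType) (q : nat) (T : choiceType) (adj : rel T).
Hypotheses (q_gt0 : (0 < q)%N) (hT : homogeneous_tree q adj).

Lemma finite_neighbors v : finite_set (neighbors adj v).
Proof. by exists q.+1; apply: hT.2. Qed.

Lemma mu1_linear : linear (@mu1 R q T adj).
Proof.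
move=> a f g; apply/funext => v; rewrite /mu1 !fctE /=.
rewrite !(fsbig_finite _ _ (finite_neighbors v)) /= big_split /= scalerDr.
by rewrite -scaler_sumr !scalerA mulrC.
Qed.

Lemma mu1_surj (z : R[i]) (g : vfun R T) : exists f, mu1 q adj f - z *: f = g.
Proof.
have [[_ [adjC _] _ _] cardN] := hT.
have [d dP] := tree_level hT.1.
(* There are at least two neighbours since [q > 0], and two distinct ones cannot both have level at
   most [d v]. *)
have child v : exists w, adj v w /\ (d v < d w)%N.
  apply: contrapT => noc.
  have low w : adj v w -> (d w <= d v)%N.
    by move=> vw; rewrite leqNgt; apply/negP => vw'; apply: noc; exists w.
  have := card_fset_set (cardN v); have := finmap.fset_uniq (fset_set (neighbors adj v)).
  have mem w : w \in finmap.enum_fset (fset_set (neighbors adj v)) -> adj v w.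
    by move=> wN; have := in_fset_set (finite_neighbors v) w; rewrite wN => /esym/set_mem.
  case: (finmap.enum_fset _) mem => [|a [|b s]] mem; [by []|by case: q q_gt0|].
  have [va vb] : adj v a /\ adj v b by split; apply: mem; rewrite !inE eqxx ?orbT.
  by rewrite (dP _ _ _ va vb (low _ va) (low _ vb)) /= inE eqxx.
have [c cP] := choice child.
have cinj v w : c v = c w -> v = w.
  move=> vw; have [vc dv] := cP v; have [wc dw] := cP w.
  by apply: (dP (c v)); [rewrite adjC | rewrite vw adjC | exact: ltnW | rewrite vw ltnW].
have inv x : exists w, forall v, w = Some v <-> c v = x.
  have [[v vx]|nx] := pselect (exists v, c v = x).
    by exists (Some v) => w; split=> [[<-]//|wx]; congr Some; apply: cinj; rewrite vx wx.
  by exists None => w; split=> // wx; case: nx; exists w.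
have [ci ciP] := choice inv.
(* The unknown [u v] stands for the value at the chosen child [c v]; vertices that are nobody's
   chosen child, such as the root, get 0. *)
pose ext (u : T -> R[i]^o) x := if ci x is Some v then u v else 0.
(* The equation at [v] solved for the value at [c v]. *)
pose E u v : R[i]^o := q.+1%:R *: (z *: ext u v + g v)
  - \sum_(w \in neighbors adj v `\ c v) ext u w.
have [u uE] : exists u, forall v, u v = E u v.
  apply: (level_recursion (0 : R[i]^o) (d := d)) => u u' v uu'.
  have extE x : (forall w, c w = x -> (d w < d v)%N) -> ext u x = ext u' x.
    by rewrite /ext; case: (ci x) (ciP x) => // w xP /(_ w) wv; apply/uu'/wv/xP.
  rewrite /E extE => [|w <-]; last by case: (cP w).
  congr (_ - _); apply: eq_fsbigr => x; rewrite inE => -[/= vx xv].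
  (* If [d v <= d x], then [v] and [w] are both neighbours of [x] not above its level, hence equal,
     forcing [x = c v]. *)
  apply: extE => w wx; have [ww dw] := cP w; rewrite wx in ww dw.
  apply: (ltn_trans dw); rewrite ltnNge; apply/negP => vx'.
  case: xv; rewrite /= -wx; congr c.
  by apply: (dP x) => //; [rewrite adjC | rewrite adjC | exact: ltnW].
exists (ext u); apply/funext => v; rewrite !fctE /mu1.
rewrite (fsbigD1 (c v)) /=; [|exact: finite_neighbors|by case: (cP v)].
rewrite {1}/ext (ciP (c v) v).2 // uE /E subrK scalerA mulVf ?pnatr_eq0 //.
by rewrite scale1r addrC addKr.
Qed.
End Tree.

Theorem theorem5p6 (R : realType) (q : nat) (T : choiceType) (adj : rel T)
    (hq : (1 <= q)%N) (hT : homogeneous_tree q adj)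
    (k l : nat) (hk : (2 <= k)%N) (hkl : (k < l)%N) :
  let U := chebU R[i] in
  let mu := @mu1 R q T adj in
  let d := gcdn k l in
  let W := U (k - 1)%N %/ U (d - 1)%N in
  let V := U (l - 1)%N %/ U (d - 1)%N in
  [/\ U (d - 1)%N %| U (k - 1)%N,
      U (d - 1)%N %| U (l - 1)%N
    & forall f g h : vfun R T,
        poly_op W mu (g + poly_op (U (l - 2)%N) mu f) =
        poly_op V mu (h + poly_op (U (k - 2)%N) mu f)
        <->
        exists F : int -> vfun R T,
          [/\ wave q adj F, F 0 = f, F l%:Z = g & F k%:Z = h] ].
Proof.
move=> U mu d W V.
have d0 : (0 < d)%N by rewrite gcdn_gt0 (ltn_trans _ hk).
(* Passing to the shifted sequence [S]; the bounds on [n] make the truncated subtractions exact. *)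
have UE n : (0 < n)%N -> U (n - 1)%N = chebS R[i] n by case: n => // n; rewrite subn1.
have UE2 n : (1 < n)%N -> U (n - 2)%N = chebS R[i] n.-1.
  by case: n => [|[|n]] // _; rewrite subn2.
have k0 : (0 < k)%N by apply: ltn_trans hk.
have l0 : (0 < l)%N by apply: ltn_trans hkl.
have l1 : (1 < l)%N by apply: ltn_trans hkl.
split; rewrite ?(UE d) ?(UE k) ?(UE l) //.
- by rewrite dvdp_chebS ?dvdn_gcdl.
- by rewrite dvdp_chebS ?dvdn_gcdr.
move=> f g h; rewrite /W /V !UE // !UE2 //.
pose A : {linear vfun R T -> vfun R T} :=
  HB.pack mu (GRing.isLinear.Build _ _ _ _ mu (mu1_linear hT)).
exact: (wave_through (A := A) f g h (mu1_surj hq hT) k0 l0).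
Qed.
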